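(* For any positive integer $n$, $$\tilde{r}(P_{10}, P_n) \ge \frac{5}{3}n - 2.$$
   Context: $P_\ell$ denotes the path on $\ell$ vertices. For finite graphs $G,H$, the online Ramsey number $\tilde{r}(G,H)$ is defined via the following game between Builder and Painter on the infinite vertex set $\mathbb{N}$: in each round Builder selects a previously unselected edge between two vertices and Painter colours it red or blue; the game ends as soon as there is a red copy of $G$ or a blue copy of $H$. Builder aims to minimise and Painter to maximise the number of rounds; $\tilde{r}(G,H)$ is the number of rounds under optimal play by both. *)

(* Defs.v *)
From mathcomp Require Import all_boot.
From mathcomp Require Import finmap.
From mathcomp Require Import boolp.

Set Implicit Arguments.
Unset Strict Implicit.
Unset Printing Implicit Defensive.

Local Open Scope fset_scope.

Record sgraph := SGraph {
  vertex :> finType;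
  adj : rel vertex;
  adj_sym : symmetric adj;
  adj_irrefl : irreflexive adj }.

Definition path_adj (l : nat) : rel 'I_l :=
  fun i j => (i.+1 == j :> nat) || (j.+1 == i :> nat).

Lemma path_adj_sym l : symmetric (@path_adj l).
Proof. by move=> i j; rewrite /path_adj orbC. Qed.

Lemma path_adj_irrefl l : irreflexive (@path_adj l).
Proof. by move=> i; rewrite /path_adj orbb gtn_eqF. Qed.

(* The path on l vertices (not l edges). *)
Definition path_graph (l : nat) : sgraph :=
  SGraph (@path_adj_sym l) (@path_adj_irrefl l).

(* The edge between the distinct vertices x and y of the board is the
   unordered pair [fset x; y]. *)
Definition edges := {fset {fset nat}}.

(* Copies are subgraphs, not necessarily induced. *)
Definition has_copy (G : sgraph) (E : edges) : Prop :=
  exists2 f : G -> nat, injective f &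
    forall u v : G, adj u v -> [fset f u; f v] \in E.

Definition game_over (G H : sgraph) (red blue : edges) : Prop :=
  has_copy G red \/ has_copy H blue.

(* From the position (red, blue), Builder can force the game to end after at
   most k further rounds. *)
Fixpoint builder_forces (G H : sgraph) (k : nat) (red blue : edges) : Prop :=
  game_over G H red blue \/
  if k is k'.+1 then
    exists x y : nat,
      [/\ x != y, [fset x; y] \notin red `|` blue,
          builder_forces G H k' ([fset x; y] |` red) blue &
          builder_forces G H k' red ([fset x; y] |` blue)]
  else False.

(* Ramsey's theorem: by selecting all edges of a large enough complete graph,
   Builder ends the game, so that the online Ramsey number is well defined. *)
Definition clique (c : rel nat) (b : bool) (K : seq nat) : Prop :=
  uniq K /\ {in K &, forall x y, x != y -> c x y = b}.

Lemma ramsey (s t : nat) : exists N, forall (c : rel nat) (S : seq nat),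
  symmetric c -> uniq S -> N <= size S ->
  exists2 K : seq nat, {subset K <= S} &
    (size K = s /\ clique c true K) \/ (size K = t /\ clique c false K).
Proof.
elim: s t => [|s IHs] t.
  by exists 0 => c S _ _ _; exists [::] => //; left.
elim: t => [|t [N2 HN2]].
  by exists 0 => c S _ _ _; exists [::] => //; right.
have [N1 HN1] := IHs t.+1.
exists (N1 + N2).+1 => c [//|x S] c_sym /= /andP[xS uS] leS.
have ext b K : clique c b K -> {subset K <= [seq y <- S | c x y == b]} ->
    clique c b (x :: K) /\ {subset x :: K <= x :: S}.
  move=> [uK cK] KS; split; last first.
    move=> y; rewrite !inE => /orP[->//|/KS].
    by rewrite mem_filter => /andP[_ ->]; rewrite orbT.
  split=> /=.
    by rewrite uK andbT; apply/negP => /KS; rewrite mem_filter (negPf xS) andbF.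
  move=> y z; rewrite !inE => /orP[/eqP->|yK] /orP[/eqP->|zK].
  - by rewrite eqxx.
  - by move=> _; move: (KS _ zK); rewrite mem_filter => /andP[/eqP].
  - by move=> _; move: (KS _ yK); rewrite mem_filter c_sym => /andP[/eqP].
  - exact: cK.
have sub b K : {subset K <= [seq y <- S | c x y == b]} -> {subset K <= x :: S}.
  by move=> KS y /KS; rewrite mem_filter inE => /andP[_ ->]; rewrite orbT.
have [le1|lt1] := leqP N1 (size [seq y <- S | c x y == true]).
  have [K KS [[sK cK]|?]] := HN1 c _ c_sym (filter_uniq _ uS) le1.
    by have [? ?] := ext _ _ cK KS; exists (x :: K) => //; left; rewrite /= sK.
  by exists K; [exact: sub KS | right].
have le2 : N2 <= size [seq y <- S | c x y == false].
  have <- := leq_add2l N1; rewrite ltnS in leS; apply: leq_trans leS _.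
  rewrite !size_filter -(count_predC (fun y => c x y == true) S).
  rewrite leq_add //; first by move: lt1; rewrite size_filter => /ltnW.
  by rewrite (@eq_count _ _ (fun y => c x y == false)) // => y /=; case: (c x y).
have [K KS [?|[sK cK]]] := HN2 c _ c_sym (filter_uniq _ uS) le2.
  by exists K; [exact: sub KS | left].
by have [? ?] := ext _ _ cK KS; exists (x :: K) => //; right; rewrite /= sK.
Qed.

Lemma clique_copy (G : sgraph) (E : edges) (K : seq nat) :
  uniq K -> size K = #|G| ->
  {in K &, forall x y, x != y -> [fset x; y] \in E} -> has_copy G E.
Proof.
move=> uK sK cK; pose f (u : G) := nth 0 K (enum_rank u).
have fK (u : G) : enum_rank u < size K by rewrite sK ltn_ord.
have f_inj : injective f.
  move=> u v /eqP; rewrite nth_uniq // => /eqP uv.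
  exact/enum_rank_inj/val_inj.
exists f => // u v uv; apply: cK; rewrite ?mem_nth //.
by apply: contraTneq uv => /f_inj ->; rewrite adj_irrefl.
Qed.

Lemma builder_forcesS G H k red blue :
  builder_forces G H k red blue -> builder_forces G H k.+1 red blue.
Proof.
elim: k red blue => [|k IHk] red blue; first by case=> // ?; left.
case=> [?|[x [y [xy new Hr Hb]]]]; first by left.
by right; exists x, y; split=> //; apply: IHk.
Qed.

Lemma builder_forces_ex (G H : sgraph) :
  exists k, `[< builder_forces G H k fset0 fset0 >].
Proof.
have [N HN] := ramsey #|G| #|H|.
have over red blue :
    (forall x y, x < N -> y < N -> x != y -> [fset x; y] \in red `|` blue) ->
    game_over G H red blue.
  move=> cov; pose c x y := [fset x; y] \in red.
  have c_sym : symmetric c by move=> x y; rewrite /c fsetUC.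
  have sN : N <= size (iota 0 N) by rewrite size_iota.
  have [K KN [[sK [uK cK]]|[sK [uK cK]]]] := HN c _ c_sym (iota_uniq 0 N) sN.
    by left; apply: clique_copy uK sK cK.
  right; apply: clique_copy uK sK _ => x y xK yK xy.
  have := cov x y; move: (KN _ xK) (KN _ yK) (cK x y xK yK xy).
  by rewrite !mem_iota /c inE /= add0n => -> -> -> /= ->.
have force L red blue :
    (forall x y, x < N -> y < N -> x != y ->
      [fset x; y] \in red `|` blue \/ (x, y) \in L) ->
    builder_forces G H (size L) red blue.
  elim: L red blue => [|[x y] L IHL] red blue cov.
    by left; apply: over => x y xN yN xy; case: (cov x y xN yN xy).
  have [xy|xNy] := eqVneq x y.
    apply: builder_forcesS; apply: IHL => u v uN vN uv.
    have [?|] := cov u v uN vN uv; first by left.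
    rewrite inE => /orP[/eqP[ux vy]|]; last by right.
    by rewrite ux vy xy eqxx in uv.
  have [old|new] := boolP ([fset x; y] \in red `|` blue).
    apply: builder_forcesS; apply: IHL => u v uN vN uv.
    have [?|] := cov u v uN vN uv; first by left.
    by rewrite inE => /orP[/eqP[-> ->]|]; [left | right].
  have cov' (E : edges) : red `|` blue `<=` E -> [fset x; y] \in E ->
      forall u v, u < N -> v < N -> u != v ->
      [fset u; v] \in E \/ (u, v) \in L.
    move=> /fsubsetP sE xyE u v uN vN uv.
    have [/sE ?|] := cov u v uN vN uv; first by left.
    by rewrite inE => /orP[/eqP[-> ->]|]; [left | right].
  right; exists x, y; split=> //; apply: IHL; apply: cov'.
  - by rewrite -fsetUA fsubsetUr.
  - by rewrite !in_fsetU in_fset1 eqxx.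
  - by rewrite fsetUCA fsubsetUr.
  - by rewrite !in_fsetU in_fset1 eqxx orbT.
exists (size [seq (x, y) | x <- iota 0 N, y <- iota 0 N]); apply/asboolP.
apply: force => x y xN yN _; right.
by apply/allpairsP; exists (x, y); rewrite !mem_iota.
Qed.

(* The value of the game: the least number of rounds within which Builder can
   end it, whatever Painter does. *)
Definition online_ramsey (G H : sgraph) : nat := ex_minn (builder_forces_ex G H).

(* Main.v *)
(** Painter keeps the red graph a forest.  Components of one or two vertices
    are small; a component that reaches three vertices fixes a core (a red path
    on three vertices), to which small components are joined in red, giving
    limbs at depth at most 3 below the middle of the core.  An edge from a red
    isolated vertex [x] to a limb is blue the first time and red afterwards; in
    the latter case [x] becomes a leaf, of depth at most 4, and remembers the
    limb [m] at the other end of an earlier blue edge.  Two small components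
    are always joined in red; all other edges are blue.  A path in a rooted
    forest of depth 4 goes up and then down, so it has at most 9 vertices.

    For the bound, red edges give weight 1 to limbs and leaves, 2/3 to core
    vertices, 1/2 to the vertices of a single red edge and 0 to red isolated
    vertices.  It suffices that the average weight along a blue path is 2/3, up
    to an additive constant, when a leaf whose remembered edge [x m] is not on
    the path gets 1 more for this unused blue edge.  This follows from a
    discharging along the path: an isolated vertex has only limbs and leaves as
    blue neighbours, at most one of them a limb, and takes more from leaves;
    a leaf that uses its remembered edge takes from the limb [m]. *)
Require Import Defs.
From mathcomp Require Import all_boot all_order all_algebra.
From mathcomp Require Import finmap boolp zify lra.

Import Order.TTheory GRing.Theory Num.Theory.

Set Implicit Arguments.
Unset Strict Implicit.
Unset Printing Implicit Defensive.

Section PainterStrategy.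

Local Open Scope fset_scope.

(** * Roles of vertices and the invariant of Painter *)

Lemma fset2_inj (K : choiceType) (a b c d : K) :
  [fset a; b] = [fset c; d] -> (a = c /\ b = d) \/ (a = d /\ b = c).
Proof.
move=> E; have: c \in [fset a; b] by rewrite E in_fset2 eqxx.
have: d \in [fset a; b] by rewrite E in_fset2 eqxx orbT.
have: a \in [fset c; d] by rewrite -E in_fset2 eqxx.
have: b \in [fset c; d] by rewrite -E in_fset2 eqxx orbT.
by do 4![case/fset2P=> ?]; subst; auto.
Qed.

(* [Mate p]: the red component is the edge to [p].  [Hub] and [Spoke] make up
   the core.  The argument [p] of the other roles is the parent in the red
   forest, and [m] in [Leaf p m] is the remembered limb.  The limbs of the
   proof idea are [Limb] at depth 2 and [Twig] at depth 3. *)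
Inductive role :=
  | Lone
  | Mate of nat
  | Hub
  | Spoke of nat
  | Limb of nat
  | Twig of nat
  | Leaf of nat & nat.

Definition small (r : role) : bool :=
  match r with Lone | Mate _ => true | _ => false end.

Definition core (r : role) : bool :=
  match r with Hub | Spoke _ => true | _ => false end.

Definition limb (r : role) : bool :=
  match r with Limb _ | Twig _ => true | _ => false end.

Definition leaf (r : role) : bool := if r is Leaf _ _ then true else false.

Definition parent (r : role) : option nat :=
  match r with
  | Spoke p | Limb p | Twig p | Leaf p _ => Some p
  | _ => None
  end.

(** Only an upper bound for the distance to the hub: a limb may hang at the hub itself, and [child]
    asks merely for a strict increase. *)
Definition depth (r : role) : nat :=
  match r with
  | Spoke _ => 1 | Limb _ => 2 | Twig _ => 3 | Leaf _ _ => 4 | _ => 0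
  end.

(* Six times the share of the red edges: a core has 2 edges for 3 vertices. *)
Definition weight (r : role) : nat :=
  match r with
  | Lone => 0 | Mate _ => 3 | Hub | Spoke _ => 4 | _ => 6
  end.

(** Since [b] is not small, the relation is permanent: only small vertices change roles. *)
Definition child (st : nat -> role) (a b : nat) : bool :=
  [&& parent (st a) == Some b, ~~ small (st b) & depth (st b) < depth (st a)].

Definition red_link (st : nat -> role) (a b : nat) : Prop :=
  [\/ child st a b, child st b a | st a = Mate b].

(** The board is infinite, so [weightP] bounds the weight of every duplicate-free list of
    vertices. *)
Record painted (st : nat -> role) (R B : edges) : Prop := Painted {
  red_linkP : forall a b : nat, [fset a; b] \in R -> red_link st a b;
  mateP : forall a b : nat, st a = Mate b ->
    [/\ a <> b, st b = Mate a & [fset a; b] \in R];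
  blue_smallP : forall a b : nat, [fset a; b] \in B -> small (st a) ->
    limb (st b) || leaf (st b);
  blue_loneP : forall a b c : nat, st a = Lone -> [fset a; b] \in B ->
    [fset a; c] \in B -> limb (st b) -> limb (st c) -> b = c;
  leafP : forall a p m : nat, st a = Leaf p m ->
    [fset a; m] \in B /\ limb (st m);
  weightP : forall s, uniq s -> \sum_(v <- s) weight (st v) <= 6 * #|` R| }.

Lemma painted0 : painted (fun=> Lone) fset0 fset0.
Proof. by split=> // s _; rewrite big1. Qed.

(** * Colouring steps that preserve the invariant *)

Lemma leq_sum_increments (h h' : nat -> nat) (l : seq (nat * nat))
    (s : seq nat) :
  uniq s -> (forall v, h' v <= h v + \sum_(ci <- l) (v == ci.1) * ci.2) ->
  \sum_(v <- s) h' v <= \sum_(v <- s) h v + \sum_(ci <- l) ci.2.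
Proof.
move=> us le_h; apply: leq_trans (leq_sum _ (fun v _ => le_h v)) _.
rewrite big_split leq_add2l exchange_big leq_sum // => -[c i] _ /=.
rewrite -big_distrl /= -{2}[i]mul1n leq_mul2r; apply/orP; right.
have -> : \sum_(v <- s) (v == c) = count_mem c s.
  by rewrite -sum1_count [RHS]big_mkcond; apply: eq_bigr => v _ /=; case: eqP.
by rewrite count_uniq_mem // leq_b1.
Qed.

(* The list [l] records the increments of the weights. *)
Lemma paint_red (st st' : nat -> role) (R B : edges) (x y : nat)
    (l : seq (nat * nat)) :
  painted st R B -> [fset x; y] \notin R ->
  (forall v, ~~ small (st v) -> st' v = st v) ->
  (forall v, st' v = Lone -> st v = Lone) ->
  red_link st' x y ->
  (forall a b, st a = Mate b -> red_link st' a b) ->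
  (forall a b, st' a = Mate b ->
     [/\ a <> b, st' b = Mate a & [fset a; b] \in [fset x; y] |` R]) ->
  (forall a p m, st' a = Leaf p m ->
     st a = Leaf p m \/ [fset a; m] \in B /\ limb (st m)) ->
  (forall v, weight (st' v) <=
     weight (st v) + \sum_(ci <- l) (v == ci.1) * ci.2) ->
  \sum_(ci <- l) ci.2 = 6 ->
  painted st' ([fset x; y] |` R) B.
Proof.
move=> P xyR big_eq lone_eq xy old_mate new_mate new_leaf le_w sum_l.
(* Blue neighbours of small vertices are limbs or leaves, whose roles are frozen, so the blue
   clauses carry over. *)
have limb_big r : limb r || leaf r -> ~~ small r by case: r.
have child_eq a b : child st a b -> child st' a b.
  case/and3P=> pa sb db; have sa : ~~ small (st a) by case: (st a) pa.
  by rewrite /child !big_eq // pa sb.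
have link_sym a b : red_link st' a b -> red_link st' b a.
  case=> [?|?|/new_mate[_ ? _]]; [exact: Or32|exact: Or31|exact: Or33].
have small_eq v : small (st' v) -> small (st v).
  by move=> sv; apply/negPn/negP=> /[dup] /big_eq <- /negP.
split=> //.
- move=> a b; rewrite in_fset1U => /orP[/eqP/fset2_inj[[-> ->]|[-> ->]]|] //.
    exact: link_sym.
  case/(red_linkP P) => [/child_eq|/child_eq|/old_mate //];
    [exact: Or31|exact: Or32].
- move=> a b abB /small_eq sa; have lb := blue_smallP P abB sa.
  by rewrite big_eq // limb_big.
- move=> a b c /lone_eq la abB acB.
  have sa : small (st a) by rewrite la.
  rewrite !big_eq; first exact: (blue_loneP P la).
    exact: limb_big (blue_smallP P acB sa).
  exact: limb_big (blue_smallP P abB sa).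
- move=> a p m /new_leaf[/(leafP P)|] [amB lm]; split=> //;
    by rewrite big_eq // limb_big // lm.
- move=> s us; apply: leq_trans (leq_sum_increments us le_w) _.
  by rewrite sum_l cardfsU1 xyR mulnDr addnC leq_add2l (weightP P).
Qed.

Lemma paint_blue (st : nat -> role) (R B : edges) (x y : nat) :
  painted st R B ->
  (small (st x) -> limb (st y) || leaf (st y)) -> ~~ small (st y) ->
  (st x = Lone -> limb (st y) -> forall b : nat,
     [fset x; b] \in B -> ~~ limb (st b)) ->
  painted st R ([fset x; y] |` B).
Proof.
move=> P xy bigy lonex.
split; [exact: red_linkP P|exact: mateP P| | | |exact: weightP P].
- move=> a b; rewrite in_fset1U => /orP[/eqP/fset2_inj[[-> ->]|[-> _]]|] //.
    by rewrite (negPf bigy).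
  by move=> abB; apply: (blue_smallP P abB).
- move=> a b c la; have ay : a <> y by move=> ay; rewrite -ay la in bigy.
  rewrite !in_fset1U => /orP[/eqP/fset2_inj[[ax ->]|[]]|abB] //;
    move=> /orP[/eqP/fset2_inj[[ax' ->]|[]]|acB] // lb lc.
  + by rewrite ax in la acB; rewrite (negPf (lonex la lb _ acB)) in lc.
  + by rewrite ax' in la abB; rewrite (negPf (lonex la lc _ abB)) in lb.
  + exact: (blue_loneP P la abB acB lb lc).
- by move=> a p m /(leafP P)[amB ?]; rewrite in_fset1U amB orbT.
Qed.

Ltac split_eqs :=
  rewrite /=; repeat match goal with |- context [@eq_op _ ?a ?b] =>
    lazymatch type of a with
    | option _ => fail
    | _ => case: (a =P b) => ?
    end end.

Ltac use_roles :=
  repeat match goal with H : ?st ?v = _ |- context [?st ?v] => rewrite H end.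

Ltac solve_link :=
  subst; rewrite /= ?eqxx; use_roles;
  solve [ exact: Or31 | exact: Or32 | exact: Or33 ].

Ltac solve_paint_red P st l :=
  apply: (@paint_red st _ _ _ _ _ l);
  [ by []
   | by []
   | by move=> v; split_eqs; subst; use_roles; rewrite ?leq_addr
   | by move=> v; split_eqs; subst
   | by rewrite /red_link /child; split_eqs; try congruence; solve_link
   | let sa := fresh in let a := fresh "a" in let b := fresh "b" in
     move=> a b sa; have [? ? _] := mateP P sa;
     by rewrite /red_link /child; split_eqs; try congruence; solve_link
   | let E := fresh in let abR := fresh in
     let a := fresh "a" in let b := fresh "b" in
     move=> a b; split_eqs => E; try congruence;
     solve [ by subst; split=> //; rewrite in_fset1U eqxx
           | by subst; split=> //; rewrite fsetUC in_fset1U eqxx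
           | have [? ? abR] := mateP P E;
             by split=> //; try congruence; rewrite in_fset1U abR orbT ]
   | let E := fresh in move=> ? ? ?; split_eqs => E;
     solve [left; congruence | by right; case: E => *; subst]
   | by move=> v; rewrite !big_cons big_nil; split_eqs;
     subst; use_roles; rewrite ?leq_addr
   | by rewrite !big_cons big_nil ].

Lemma paint_lone_lone (st : nat -> role) (R B : edges) (x y : nat) :
  painted st R B -> x <> y -> [fset x; y] \notin R ->
  st x = Lone -> st y = Lone ->
  painted [eta st with x |-> Mate y, y |-> Mate x] ([fset x; y] |` R) B.
Proof.
move=> P xy xyR sx sy.
by solve_paint_red P st [:: (x, 3); (y, 3)].
Qed.

Lemma paint_lone_mate (st : nat -> role) (R B : edges) (x y y' : nat) :
  painted st R B -> [fset x; y] \notin R -> st x = Lone -> st y = Mate y' ->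
  painted [eta st with x |-> Spoke y, y |-> Hub, y' |-> Spoke y]
    ([fset x; y] |` R) B.
Proof.
move=> P xyR sx sy; have [yy' sy' _] := mateP P sy.
have xy : x <> y by congruence.
have xy' : x <> y' by congruence.
solve_paint_red P st [:: (x, 4); (y, 1); (y', 1)].
Qed.

(** The red path [x'], [x], [y], [y'] arises: its first three vertices become the core with hub [x],
    and [y'] becomes a limb. *)
Lemma paint_mate_mate (st : nat -> role) (R B : edges) (x x' y y' : nat) :
  painted st R B -> x <> y -> [fset x; y] \notin R ->
  st x = Mate x' -> st y = Mate y' ->
  painted [eta st with x |-> Hub, x' |-> Spoke x, y |-> Spoke x, y' |-> Limb y]
    ([fset x; y] |` R) B.
Proof.
move=> P xy xyR sx sy; have [xx' sx' xx'R] := mateP P sx.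
have [yy' sy' _] := mateP P sy.
have x'y : x' <> y by move=> x'y; rewrite -x'y xx'R in xyR.
have xy' : x <> y' by congruence.
have x'y' : x' <> y' by congruence.
solve_paint_red P st [:: (x, 1); (x', 1); (y, 1); (y', 3)].
Qed.

Lemma paint_lone_core (st : nat -> role) (R B : edges) (x y : nat) :
  painted st R B -> [fset x; y] \notin R -> st x = Lone -> core (st y) ->
  painted [eta st with x |-> Limb y] ([fset x; y] |` R) B.
Proof.
move=> P xyR sx; case sy: (st y) => [|?||?|?|?|? ?] // _.
all: have xy : x <> y by congruence.
all: solve_paint_red P st [:: (x, 6)].
Qed.

Lemma paint_mate_core (st : nat -> role) (R B : edges) (x x' y : nat) :
  painted st R B -> [fset x; y] \notin R -> st x = Mate x' -> core (st y) ->
  painted [eta st with x |-> Limb y, x' |-> Twig x] ([fset x; y] |` R) B.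
Proof.
move=> P xyR sx; have [xx' sx' _] := mateP P sx.
case sy: (st y) => [|?||?|?|?|? ?] // _.
all: have xy : x <> y by congruence.
all: have x'y : x' <> y by congruence.
all: solve_paint_red P st [:: (x, 3); (x', 3)].
Qed.

Lemma paint_lone_limb (st : nat -> role) (R B : edges) (x y m : nat) :
  painted st R B -> [fset x; y] \notin R -> st x = Lone -> limb (st y) ->
  [fset x; m] \in B -> limb (st m) ->
  painted [eta st with x |-> Leaf y m] ([fset x; y] |` R) B.
Proof.
move=> P xyR sx; case sy: (st y) => [|?||?|?|?|? ?] // _ xmB lm.
all: have xy : x <> y by congruence.
all: solve_paint_red P st [:: (x, 6)].
Qed.

Lemma painter_reply (st : nat -> role) (R B : edges) (x y : nat) :
  painted st R B -> x <> y -> [fset x; y] \notin R ->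
  (exists st', painted st' ([fset x; y] |` R) B) \/
  painted st R ([fset x; y] |` B).
Proof.
move=> P; wlog lexy : x y / small (st y) -> small (st x).
  move=> reply xy xyR; have [sx|bigx] := boolP (small (st x)).
    by apply: reply.
  rewrite (fsetUC [fset x]) in xyR *.
  by apply: reply; rewrite ?(negPf bigx) //; apply/nesym.
move=> xy xyR.
have [small_y|bigy] := boolP (small (st y)).
  left; have small_x := lexy small_y; move: small_x small_y.
  case sx: (st x) => [|x'||?|?|?|? ?] // _;
    case sy: (st y) => [|y'||?|?|?|? ?] // _.
  - by eexists; apply: paint_lone_lone sx sy.
  - by eexists; apply: paint_lone_mate sx sy.
  - by rewrite fsetUC in xyR *; eexists; apply: paint_lone_mate sy sx.
  - by eexists; apply: paint_mate_mate sx sy.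
have [small_x|bigx] := boolP (small (st x)); last first.
  right; apply: paint_blue => //; first by rewrite (negPf bigx).
  by move=> lx; rewrite lx in bigx.
have [cy|ncy] := boolP (core (st y)).
  left; move: small_x; case sx: (st x) => [|x'||?|?|?|? ?] // _.
    by eexists; apply: paint_lone_core cy.
  by eexists; apply: paint_mate_core sx cy.
have outer_y : limb (st y) || leaf (st y) by case: (st y) bigy ncy.
(* The only case in which the colour depends on earlier blue edges. *)
have [[m xmB [lx ly lm]]|no_limb] := pselect (exists2 m, [fset x; m] \in B &
    [/\ st x = Lone, limb (st y) & limb (st m)]).
  by left; eexists; apply: paint_lone_limb xmB lm.
right; apply: paint_blue => // lx ly b xbB; apply/negP => lb.
by apply: no_limb; exists b.
Qed.

(** * Absence of a red path on ten vertices *)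

Lemma painted_path10_free (st : nat -> role) (R B : edges) :
  painted st R B -> ~ has_copy (path_graph 10) R.
Proof.
move=> P [f f_inj fR]; pose v i := f (inord i).
have v_inj i j : i < 10 -> j < 10 -> v i = v j -> i = j.
  by move=> i10 j10 /f_inj /(congr1 (@nat_of_ord _)); rewrite !inordK.
have vR i : i.+1 < 10 -> [fset v i; v i.+1] \in R.
  by move=> i10; apply: fR; rewrite /= /path_adj !inordK ?eqxx // ltnW.
have depth4 i : depth (st (v i)) <= 4 by case: (st _).
have childP a b : child st a b ->
    parent (st a) = Some b /\ depth (st b) < depth (st a).
  by case/and3P=> /eqP.
have descend i : i.+2 < 10 -> child st (v i.+1) (v i) ->
    child st (v i.+2) (v i.+1).
  move=> i10 /childP[pi _].
  case: (red_linkP P (vR _ i10)) => [/childP[]|//|mi]; last by rewrite mi in pi.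
  by rewrite pi => -[/v_inj]; lia.
have ascend i : i.+2 < 10 -> child st (v i.+1) (v i.+2) ->
    child st (v i) (v i.+1).
  move=> i10 /childP[pi _].
  case: (red_linkP P (vR _ (ltnW i10))) => [//|/childP[]|/(mateP P)[_ mi _]].
    by rewrite pi => -[/v_inj]; lia.
  by rewrite mi in pi.
(* The middle of the nine edges, going up or down, forces the same direction on all edges before or
   after it. Five strict changes of depth exceed 4. *)
case: (red_linkP P (vR 4 isT)) => [c4|c4|m4].
- have c3 := ascend 3 isT c4; have c2 := ascend 2 isT c3.
  have c1 := ascend 1 isT c2; have c0 := ascend 0 isT c1.
  move: c0 c1 c2 c3 c4 (depth4 0).
  move=> /childP[_ ?] /childP[_ ?] /childP[_ ?] /childP[_ ?] /childP[_ ?]; lia.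
- have c5 := descend 4 isT c4; have c6 := descend 5 isT c5.
  have c7 := descend 6 isT c6; have c8 := descend 7 isT c7.
  move: c8 c7 c6 c5 c4 (depth4 9).
  move=> /childP[_ ?] /childP[_ ?] /childP[_ ?] /childP[_ ?] /childP[_ ?]; lia.
- have [_ m5 _] := mateP P m4.
  case: (red_linkP P (vR 5 isT)); rewrite /child m5 ?andbF //.
  by case=> /v_inj; lia.
Qed.

(** * Discharging along a blue path with [n] edges *)

Section BluePath.

Variables (st : nat -> role) (R B : edges) (n : nat) (v : nat -> nat).
Hypothesis P : painted st R B.
Hypothesis v_inj : forall i j, i <= n -> j <= n -> v i = v j -> i = j.
Hypothesis vB : forall i, i < n -> [fset v i; v i.+1] \in B.

Let path_edge i := [fset v i; v i.+1].

Let mark i := if st (v i) is Leaf _ m then m else 0.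

Let wasted i :=
  leaf (st (v i)) && ([fset v i; mark i] \notin map path_edge (iota 0 n)).

(** A remembered edge joins a leaf to a limb, so it determines its leaf: distinct wasted leaves give
    distinct blue edges off the path. *)
Lemma blue_waste : n + \sum_(i < n.+1) wasted i <= #|` B|.
Proof.
have markP i : leaf (st (v i)) ->
    [fset v i; mark i] \in B /\ limb (st (mark i)).
  by rewrite /mark; case si: (st (v i)) => [|?||?|?|?|? m] // _;
    apply: (leafP P si).
pose W := map (fun i => [fset v i; mark i]) (filter wasted (iota 0 n.+1)).
have -> : (n + \sum_(i < n.+1) wasted i)%N =
    size (map path_edge (iota 0 n) ++ W).
  rewrite size_cat !size_map size_iota size_filter -sum1_count; congr addn.
  rewrite -(big_mkord predT (fun i => wasted i : nat)) [RHS]big_mkcond.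
  by rewrite /index_iota subn0; apply: eq_bigr => i _; case: (wasted i).
apply: uniq_leq_size; last first.
  move=> e; rewrite mem_cat => /orP[] /mapP[i].
    by rewrite mem_iota => /andP[_ ?] ->; apply: vB.
  by rewrite mem_filter => /andP[/andP[/markP[? _] _] _] ->.
rewrite cat_uniq; apply/and3P; split.
- rewrite map_inj_in_uniq ?iota_uniq // => i j; rewrite !mem_iota /=.
  by move=> ? ? /fset2_inj[[/v_inj ? _]|[/v_inj ? /v_inj ?]]; lia.
- apply/hasPn => e /mapP[i]; rewrite mem_filter => /andP[/andP[_ wi] _] ->.
  exact: wi.
- rewrite map_inj_in_uniq ?filter_uniq ?iota_uniq // => i j.
  rewrite !mem_filter !mem_iota /=.
  move=> /andP[/andP[/markP[_ mi] _] ni] /andP[/andP[lj _] nj].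
  case/fset2_inj=> [[/v_inj ? _]|[_ mij]]; first lia.
  by rewrite mij in mi; case: (st (v j)) lj mi.
Qed.

(* What [b] hands over to its neighbour [a] on the path, in sixths. *)
Let gift (a b : nat) : nat :=
  match st a with
  | Lone => if leaf (st b) then 3 else 1
  | Mate _ => 1
  | Leaf _ m => m == b
  | _ => 0
  end.

(** Small vertices have only limbs and leaves as blue neighbours, and a leaf takes only from its
    remembered limb. *)
Lemma gift_le (a b : nat) : [fset a; b] \in B ->
  gift a b <= if leaf (st b) then 3 else limb (st b).
Proof.
move=> abB; have := blue_smallP P abB; rewrite /gift.
case sa: (st a) => [|?||?|?|?|? m] //=; try by move=> /(_ isT); case: (st b).
case: eqP => // mb _; have [_] := leafP P sa.
by rewrite mb => ->; case: (leaf _).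
Qed.

Lemma gift_ge (a b : nat) : small (st a) -> 0 < gift a b.
Proof. by rewrite /gift; case: (st a) => // _; case: (leaf _). Qed.

(** An end may have a single giver, so it is held to 1 instead of 4; the two deficits of 3 make the
    6 in [path_weight]. *)
Lemma balance_end (c a : nat) (w : bool) : [fset c; a] \in B ->
  (forall p m, st c = Leaf p m -> w || (m == a)) ->
  1 + gift a c <= weight (st c) + 6 * w + gift c a.
Proof.
move=> caB wP; have acB : [fset a; c] \in B by rewrite fsetUC.
have := gift_le acB; have := @gift_ge c a.
case sc: (st c) wP => [|?||?|?|?|? m] //= wP; try by move=> /(_ isT); lia.
all: by move=> _; lia.
Qed.

(** [Lone] gets at least 3 + 1, as [a] and [d] are not both limbs; [Mate] has 3 + 1 + 1; the core
    keeps 4; a limb keeps at least 6 - 1 - 1. A leaf keeps at least 6 + 1 - 3 if its remembered edge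
    is on the path, and 12 - 3 - 3 under [w]. *)
Lemma balance_inner (c a d : nat) (w : bool) : a <> d ->
  [fset c; a] \in B -> [fset c; d] \in B ->
  (forall p m, st c = Leaf p m -> [|| w, m == a | m == d]) ->
  4 + gift a c + gift d c <= weight (st c) + 6 * w + gift c a + gift c d.
Proof.
move=> ad caB cdB wP.
have acB : [fset a; c] \in B by rewrite fsetUC.
have dcB : [fset d; c] \in B by rewrite fsetUC.
have := gift_le acB; have := gift_le dcB.
have outer (z : nat) : [fset c; z] \in B -> small (st c) ->
    limb (st z) || leaf (st z).
  exact: (blue_smallP P).
case sc: (st c) wP => [|?||?|?|?|p m] /= wP; try lia.
- have := blue_loneP P sc caB cdB.
  have := outer _ caB; have := outer _ cdB; rewrite /gift !sc.
  case: (st a) => [|?||?|?|?|? ?] //=; try (by move=> ? /(_ isT));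
    case: (st d) => [|?||?|?|?|? ?] //=; try (by move=> /(_ isT));
    by move=> _ _ same ? ?; solve [lia | case: ad; apply: same].
- have gift1 (z : nat) : gift c z = 1 by rewrite /gift sc.
  by rewrite !gift1; lia.
- have [_ lm] := leafP P sc.
  have no_gift (z : nat) : m = z -> gift z c = 0.
    by move=> <-; rewrite /gift; case: (st m) lm.
  have gift1 (z : nat) : m = z -> gift c z = 1.
    by move=> <-; rewrite /gift sc eqxx.
  case/or3P: (wP _ _ erefl) => [->|/eqP mz|/eqP mz]; first lia.
    by rewrite (no_gift _ mz) (gift1 _ mz); lia.
  by rewrite (no_gift _ mz) (gift1 _ mz); lia.
Qed.

Lemma wastedP i p m : i <= n -> st (v i) = Leaf p m ->
  [|| wasted i, (0 < i) && (m == v i.-1) | (i < n) && (m == v i.+1)].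
Proof.
move=> le_in si; rewrite /wasted /mark si /=.
case: mapP => // -[j]; rewrite mem_iota /= => jn.
case/fset2_inj=> [[/v_inj ij mj]|[/v_inj ij mj]].
  have -> : i = j by lia.
  by rewrite mj jn eqxx orbT.
have -> : i = j.+1 by lia.
by rewrite mj /= eqxx.
Qed.

(** Gifts inside the prefix cancel; only the exchange across its last edge and the deficit 3 of the
    first vertex remain. *)
Lemma prefix_weight k : k < n ->
  4 * k.+1 + gift (v k.+1) (v k) <=
    \sum_(i < k.+1) (weight (st (v i)) + 6 * wasted i) +
    gift (v k) (v k.+1) + 3.
Proof.
elim: k => [|k IHk] kn.
  rewrite big_ord_recl big_ord0 /=.
  have := balance_end (w := wasted 0) (vB kn).
  have wP p m : st (v 0) = Leaf p m -> wasted 0 || (m == v 1).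
    by move=> /(wastedP (leq0n n)); rewrite kn.
  by move=> /(_ wP); lia.
rewrite big_ord_recr /=; have := IHk (ltnW kn).
have ad : v k <> v k.+2 by move=> /v_inj; lia.
have caB : [fset v k.+1; v k] \in B by rewrite fsetUC; apply: vB; lia.
have := balance_inner (w := wasted k.+1) ad caB (vB kn).
have wP p m : st (v k.+1) = Leaf p m ->
    [|| wasted k.+1, m == v k | m == v k.+2].
  by move=> /(wastedP (ltnW kn)); rewrite kn.
by move=> /(_ wP); set S := \sum_(i < _) _; lia.
Qed.

Lemma path_weight :
  4 * n.+1 <= \sum_(i < n.+1) (weight (st (v i)) + 6 * wasted i) + 6.
Proof.
case En: n => [|k]; first by lia.
have kn : k < n by rewrite En.
rewrite big_ord_recr /=; have := prefix_weight kn.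
have caB : [fset v k.+1; v k] \in B by rewrite fsetUC; apply: vB.
have := balance_end (w := wasted k.+1) caB.
have wP p m : st (v k.+1) = Leaf p m -> wasted k.+1 || (m == v k).
  by move=> /(wastedP kn); rewrite En ltnn orbF.
by move=> /(_ wP); set S := \sum_(i < _) _; lia.
Qed.

Lemma blue_path_bound : 5 * n.+1 <= 3 * (#|` R| + #|` B|) + 6.
Proof.
have us : uniq (map v (iota 0 n.+1)).
  rewrite map_inj_in_uniq ?iota_uniq // => i j; rewrite !mem_iota /= => ? ?.
  by apply: v_inj; lia.
have := weightP P us; rewrite big_map.
rewrite -[iota 0 n.+1]/(index_iota 0 n.+1) big_mkord.
(* Six times [blue_waste], added to [path_weight] and [weightP], is twice the claim. *)
have := path_weight; have := blue_waste.
rewrite big_split -big_distrr /=; lia.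
Qed.

End BluePath.

(** * From the invariant to the length of the game *)

Lemma painted_blue_path (st : nat -> role) (R B : edges) (n : nat) :
  painted st R B -> has_copy (path_graph n) B ->
  5 * n <= 3 * (#|` R| + #|` B|) + 6.
Proof.
case: n => [|n] P; first by rewrite muln0.
case=> f f_inj fB; apply: (@blue_path_bound st _ _ _ (f \o inord)) => //=.
  by move=> i j ? ? /f_inj /(congr1 (@nat_of_ord _)); rewrite !inordK.
by move=> i i_n; apply: fB; rewrite /= /path_adj !inordK ?eqxx // ltnW.
Qed.

(** Each round moves one unit from [k] to the number of coloured edges, so the right-hand side is
    constant in the induction. *)
Lemma painted_forces (st : nat -> role) (R B : edges) (n k : nat) :
  painted st R B -> builder_forces (path_graph 10) (path_graph n) k R B ->
  5 * n <= 3 * (#|` R| + #|` B| + k) + 6.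
Proof.
have over k' st' R' B' : painted st' R' B' ->
    game_over (path_graph 10) (path_graph n) R' B' ->
    5 * n <= 3 * (#|` R'| + #|` B'| + k') + 6.
  move=> P [/(painted_path10_free P) //|/(painted_blue_path P)]; lia.
elim: k st R B => [|k IHk] st R B P; first by case=> // /(over 0 _ _ _ P).
case=> [|[x [y [/eqP xy]]]]; first exact: over P.
rewrite in_fsetU => /norP[xyR xyB] forceR forceB.
case: (painter_reply P xy xyR) => [[st' P']|P'].
  by have := IHk _ _ _ P' forceR; rewrite cardfsU1 xyR; lia.
by have := IHk _ _ _ P' forceB; rewrite cardfsU1 xyB; lia.
Qed.

End PainterStrategy.

Local Open Scope ring_scope.

Theorem theorem2p1 (n : nat) (hn : (0 < n)%N) :
  (5 / 3 * n%:R - 2 : rat) <= (online_ramsey (path_graph 10) (path_graph n))%:R.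
Proof.
rewrite /online_ramsey; case: ex_minnP => k /asboolP force_k _.
have := painted_forces painted0 force_k; rewrite cardfs0 !add0n.
rewrite -(ler_nat rat) natrD !natrM; lra.
Qed.
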